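(* Let $\mathcal S$ be a Banach standard sequence space, and let $X$ and $Y$ be standard sequence classes, with $Y$ linearly stable. Let $E$ be a Banach space and let $\mathcal I$ be a (quasi-)Banach operator ideal. Then the set $$\mathcal I(E;\mathcal S)\setminus\mathcal L_{X;Y}(E;\mathcal S)$$ is either empty or pointwise $\mathfrak c$-spaceable in $\mathcal I(E;\mathcal S)$.
   Context: Banach spaces are over $\mathbb K=\mathbb R$ or $\mathbb C$; $\mathfrak c$ is the cardinality of $\mathbb R$; $\mathcal L(E;F)$ is the space of bounded linear operators from $E$ to $F$. Standard sequence class: a rule $X$ assigning to each Banach space $E$ a (quasi-)Banach space $X(E)$ of $E$-valued sequences (with coordinatewise operations) such that: (i) there is a constant $C>0$ with $c_{00}(E)\subseteq X(E)\subseteq\ell_\infty(E)$ and $\|\cdot\|_{\ell_\infty(E)}\le C\|\cdot\|_{X(E)}$ on $X(E)$, where $c_{00}(E)$ is the space of eventually null and $\ell_\infty(E)$ the space of bounded $E$-valued sequences; (ii) if $x=(x_j)_j\in X(E)$ and $(x_{n_k})_k$ is a subsequence, then $(x_{n_k})_k\in X(E)$ and $\|(x_{n_k})_k\|_{X(E)}\le\|x\|_{X(E)}$; (iii) if $x=(x_j)_j\in X(E)$ and $n_1<n_2<\cdots$ are natural numbers, then the sequence $y$ having $x_i$ in coordinate $n_i$ for every $i$ and $0$ in all other coordinates belongs to $X(E)$ and $\|y\|_{X(E)}\le\|x\|_{X(E)}$. A standard sequence space is a space of the form $Z(G)$ with $Z$ a standard sequence class and $G$ a Banach space; a Banach standard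 sequence space is one that is a Banach space. $(X;Y)$-summing operators: $u\in\mathcal L(E;F)$ belongs to $\mathcal L_{X;Y}(E;F)$ if $(u(x_j))_{j}\in Y(F)$ whenever $(x_j)_{j}\in X(E)$. A standard sequence class $Y$ is linearly stable if $\mathcal L_{Y;Y}=\mathcal L$, i.e. for all Banach spaces $E,F$, every $T\in\mathcal L(E;F)$ and every $(x_j)_j\in Y(E)$, one has $(T(x_j))_j\in Y(F)$. Operator ideal: a subclass $\mathcal I$ of the class $\mathcal L$ of all bounded linear operators between Banach spaces such that each component $\mathcal I(E;F)=\mathcal L(E;F)\cap\mathcal I$ is a linear subspace of $\mathcal L(E;F)$ containing all finite-rank operators, and $v\circ T\circ u\in\mathcal I(E;F)$ whenever $u\in\mathcal L(E;E_0)$, $T\in\mathcal I(E_0;F_0)$, $v\in\mathcal L(F_0;F)$. It is a quasi-Banach operator ideal if there is a map $\|\cdot\|_{\mathcal I}:\mathcal I\to[0,\infty)$ whose restriction to each component is a complete quasi-norm, with $\|\mathrm{id}_{\mathbb K}\|_{\mathcal I}=1$ and $\|T_1T_2T_3\|_{\mathcal I}\le\|T_1\|\,\|T_2\|_{\mathcal I}\,\|T_3\|$ for composable $T_1,T_3\in\mathcal L$, $T_2\in\mathcal I$. The space $\mathcal I(E;\mathcal S)$ carries the topology of this quasi-norm. Pointwise $\mathfrak c$-spaceable: a subset $A$ of a topological vector space $V$ is pointwise $\mathfrak c$-spaceable if for every $x\in A$ there is a closed $\mathfrak c$-dimensional (Hamel dimension) subspace $W_x$ of $V$ with $x\in W_x\subset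 A\cup\{0\}$. *)

(* Defs.v *)
From HB Require Import structures.
From mathcomp Require Import all_boot all_order all_algebra.
From mathcomp Require Import complex.
From mathcomp Require Import boolp classical_sets functions cardinality filter.
From mathcomp Require Import reals topology normedtype.

Set Implicit Arguments.
Unset Strict Implicit.
Unset Printing Implicit Defensive.

Import Order.TTheory GRing.Theory Num.Theory.
Import numFieldNormedType.Exports.

Local Open Scope classical_set_scope.
Local Open Scope ring_scope.

(** A linear subspace of [V] with a quasi-norm of its own; the values of
    [qnorm] outside of the subspace are irrelevant.  As for [normedModType K],
    (quasi-)norms take values in the scalar field [K]; when [K] is [R[i]],
    [0 <= x] means that [x] is real and nonnegative. *)
Record quasiNormedSubspace (K : numFieldType) (V : lmodType K) := {
  qcarrier :> V -> Prop;
  qnorm : V -> K;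
  qcarrier0 : qcarrier 0;
  qcarrierP : forall (a : K) (x y : V),
    qcarrier x -> qcarrier y -> qcarrier (a *: x + y);
  qnorm_ge0 : forall x, qcarrier x -> 0 <= qnorm x;
  qnorm_eq0 : forall x, qcarrier x -> qnorm x = 0 -> x = 0;
  qnormZ : forall (a : K) x, qcarrier x -> qnorm (a *: x) = `|a| * qnorm x;
  qnormD : exists2 k : K, 1 <= k & forall x y, qcarrier x -> qcarrier y ->
    qnorm (x + y) <= k * (qnorm x + qnorm y)
}.

Section QuasiNormedSpace.
Context {K : numFieldType} {V : lmodType K} (W : quasiNormedSubspace V).

(** The subspace as a type, with the topology and the uniform structure of its
    quasi-norm (not the ones that it could inherit from [V]). *)
Definition qspace : Type := {x : V | `[< W x >]}.
Definition qspace_val (x : qspace) : V := proj1_sig x.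

HB.instance Definition _ := [isSub of qspace for qspace_val].
HB.instance Definition _ := [Choice of qspace by <:].

Lemma qspace_submod_closed : subsemimod_closed (fun x : V => `[< W x >]).
Proof.
have h0 : W 0 by exact: qcarrier0.
split.
  split; first exact/asboolP.
  move=> x y /asboolP Wx /asboolP Wy; apply/asboolP; rewrite -[x]scale1r.
  exact: qcarrierP.
move=> a x /asboolP Wx; apply/asboolP; rewrite -[_ *: _]addr0.
exact: qcarrierP.
Qed.

HB.instance Definition _ :=
  GRing.SubChoice_isSubLmodule.Build K V (fun x => `[< W x >]) qspace
    qspace_submod_closed.

Lemma qspaceP (x : qspace) : W (val x).
Proof. exact/asboolP/(valP x). Qed.

Definition qspace_norm (x : qspace) : K := qnorm W (val x).

Local Notation N := qspace_norm.

Lemma qspace_ge0 x : 0 <= N x.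
Proof. exact/qnorm_ge0/qspaceP. Qed.

Lemma qspace_normZ a x : N (a *: x) = `|a| * N x.
Proof. by rewrite /qspace_norm linearZ; exact/qnormZ/qspaceP. Qed.

Lemma qspace_norm0 : N 0 = 0.
Proof. by rewrite -(scale0r (0 : qspace)) qspace_normZ normr0 mul0r. Qed.

Lemma qspace_normN x : N (- x) = N x.
Proof. by rewrite -scaleN1r qspace_normZ normrN1 mul1r. Qed.

Lemma qspace_normC x y : N (x - y) = N (y - x).
Proof. by rewrite -qspace_normN opprB. Qed.

Lemma qspace_eq0 x : N x = 0 -> x = 0.
Proof. by move=> x0; apply/val_inj/(qnorm_eq0 (qspaceP x)). Qed.

Lemma qspace_normD : exists2 k : K, 1 <= k &
  forall x y, N (x + y) <= k * (N x + N y).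
Proof.
have [k k1 h] := qnormD W; exists k => // x y.
by rewrite /qspace_norm linearD; apply: h; exact: qspaceP.
Qed.

Lemma qspace_normD_lt (e : K) : 0 < e -> exists2 d : K, 0 < d &
  forall x y, N x < d -> N y < d -> N (x + y) < e.
Proof.
move=> e0; have [k k1 h] := qspace_normD.
have k0 : 0 < k by exact: lt_le_trans k1.
exists (e / (k * 2)); first by rewrite divr_gt0// mulr_gt0.
move=> x y xd yd; apply: (le_lt_trans (h x y)).
rewrite -ltr_pdivlMl//; apply: (lt_le_trans (ltrD xd yd)).
by rewrite invfM mulrA [k^-1 * e]mulrC -splitr.
Qed.

Definition qspace_ent : set_system (qspace * qspace) :=
  [set A | exists2 e : K, 0 < e & [set xy | N (xy.1 - xy.2) < e] `<=` A].

Lemma qspace_ent_filter : Filter qspace_ent.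
Proof.
split=> /=.
- by exists 1.
- move=> A B [e e0 eA] [d d0 dB].
  have ed : (e >=< d)%O by apply: real_comparable; exact: gtr0_real.
  exists (Num.min e d); first by rewrite comparable_lt_min// e0.
  by move=> xy /=; rewrite comparable_lt_min// => /andP[/eA ? /dB].
- by move=> A B AB [e e0 eA]; exists e => //; exact: subset_trans AB.
Qed.

Local Open Scope relation_scope.

Lemma qspace_ent_diagonal A : qspace_ent A -> diagonal `<=` A.
Proof.
move=> [e e0 eA] [x y] /= xy; apply: eA => /=.
by rewrite (_ : x = y)// subrr qspace_norm0.
Qed.

Lemma qspace_ent_inv A : qspace_ent A -> qspace_ent A^-1.
Proof.
move=> [e e0 eA]; exists e => // -[x y] /= xy; apply: eA => /=.
by rewrite qspace_normC.
Qed.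

Lemma qspace_ent_split A : qspace_ent A ->
  exists2 B, qspace_ent B & B \; B `<=` A.
Proof.
move=> [e /qspace_normD_lt[d d0 h] eA].
exists [set xy | N (xy.1 - xy.2) < d]; first by exists d.
move=> [x y] /= [z xz zy]; apply: eA => /=.
by rewrite -(subrK z x) -addrA; exact: h.
Qed.

Local Close Scope relation_scope.

HB.instance Definition _ := isUniform.Build qspace
  qspace_ent_filter qspace_ent_diagonal qspace_ent_inv qspace_ent_split.
HB.instance Definition _ := isPointed.Build qspace 0.

Lemma qspace_nbhsP (x : qspace) (A : set qspace) :
  nbhs x A <-> exists2 e : K, 0 < e & [set y | N (x - y) < e] `<=` A.
Proof.
rewrite nbhsP; split=> [[B [e e0 eB] BA]|[e e0 eA]].
  by exists e => // y /= xy; apply: BA; apply/mem_set; exact: eB.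
exists [set xy | N (xy.1 - xy.2) < e]; first by exists e.
by move=> y /set_mem /= /eA.
Qed.

Lemma qspace_add_continuous : continuous (fun x : qspace * qspace => x.1 + x.2).
Proof.
move=> [x y] A /= /qspace_nbhsP[e /qspace_normD_lt[d d0 h] eA].
exists ([set z | N (x - z) < d], [set z | N (y - z) < d]).
  by split; apply/qspace_nbhsP; exists d.
move=> [z t] [/= xz yt]; apply: eA => /=.
by rewrite opprD addrACA; exact: h.
Qed.

Lemma qspace_scale_continuous :
  continuous (fun z : K^o * qspace => z.1 *: z.2).
Proof.
move=> [a x] A /= /qspace_nbhsP[e /qspace_normD_lt[d d0 h] eA].
have a1 : 0 < `|a| + 1 by rewrite ltr_wpDl.
have x1 : 0 < N x + 1 by rewrite ltr_wpDl// qspace_ge0.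
exists ([set b | `|a - b| < 1 /\ `|a - b| < d / (N x + 1)],
        [set y | N (x - y) < d / (`|a| + 1)]).
  split=> /=; last by apply/qspace_nbhsP; eexists; last exact: subset_refl;
    rewrite divr_gt0.
  by apply: filterI; apply/nbhs_normP; eexists;
    try exact: subset_refl; rewrite //= divr_gt0.
move=> [b y] [/= [ab1 abd] xyd]; apply: eA => /=.
have -> : a *: x - b *: y = (a - b) *: x + b *: (x - y).
  by rewrite scalerBl scalerBr addrA subrK.
apply: h; rewrite qspace_normZ.
  rewrite (@le_lt_trans _ _ (`|a - b| * (N x + 1)))//.
    by rewrite ler_wpM2l// lerDl.
  by rewrite -ltr_pdivlMr.
have ba : `|b| <= `|a| + 1.
  rewrite -[b](subKr a) (le_trans (ler_normB _ _))// lerD2l; exact: ltW.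
rewrite (@le_lt_trans _ _ ((`|a| + 1) * N (x - y)))//.
  by rewrite ler_wpM2r// qspace_ge0.
by rewrite mulrC -ltr_pdivlMr.
Qed.

HB.instance Definition _ :=
  PreTopologicalNmodule_isTopologicalNmodule.Build qspace qspace_add_continuous.
HB.instance Definition _ :=
  TopologicalNmodule_isTopologicalLmodule.Build K qspace
    qspace_scale_continuous.

Definition qcomplete := forall F : set_system qspace,
  ProperFilter F -> cauchy F -> cvg F.

Definition triangle_inequality := forall x y, W x -> W y ->
  qnorm W (x + y) <= qnorm W x + qnorm W y.

End QuasiNormedSpace.

Arguments qcomplete {K V} W.
Arguments triangle_inequality {K V} W.

Record quasiBanachSubspace (K : numFieldType) (V : lmodType K) := {
  qb_quasiNormed :> quasiNormedSubspace V;
  qb_complete : qcomplete qb_quasiNormed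
}.

Section BanachSubspace.
Context {K : numFieldType} {V : lmodType K} (W : quasiBanachSubspace V).
Hypothesis W_norm : triangle_inequality W.

Definition banach_subspace of triangle_inequality W := qspace W.
Local Notation B := (banach_subspace W_norm).

HB.instance Definition _ := GRing.Lmodule.copy B (qspace W).

Let banach_ler_normD (x y : B) :
  qspace_norm (x + y) <= qspace_norm x + qspace_norm y.
Proof.
by rewrite /qspace_norm linearD; apply: W_norm; exact: qspaceP.
Qed.

HB.instance Definition _ := Lmodule_isNormed.Build K B
  banach_ler_normD (@qspace_normZ _ _ W) (@qspace_eq0 _ _ W).

Let banach_entourage : @entourage B = @entourage (qspace W).
Proof.
by apply/seteqP; split=> A [e e0 eA]; exists e.
Qed.

Let banach_complete (F : set_system B) : ProperFilter F -> cauchy F -> cvg F.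
Proof.
rewrite /cauchy banach_entourage => FF Fc.
have /cvg_ex[/= x Fx] := @qb_complete _ _ W _ FF Fc; apply/cvg_ex; exists x.
move=> A; rewrite nbhsP /= banach_entourage => xA.
by apply: Fx; rewrite nbhsP.
Qed.

HB.instance Definition _ := Uniform_isComplete.Build B banach_complete.

Definition banach_subspace_normedType : completeNormedModType K := B.

End BanachSubspace.

Section Operators.
Context {K : numFieldType}.
Implicit Types E F G : completeNormedModType K.

Definition bounded_linear E F (T : E -> F) : Prop :=
  linear T /\ exists M : K, forall x, `|T x| <= M * `|x|.

(** The supremum is for the order of [K], also when [K] is [R[i]]: an upper
    bound of a nonempty set of real numbers is then real. *)
Definition opnorm E F (T : E -> F) : K :=
  supremum 0 [set `|T x| | x in [set x | `|x| <= 1]].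

Definition finite_rank E F (T : E -> F) : Prop :=
  exists n (v : 'I_n -> F), forall x, exists a : 'I_n -> K,
    T x = \sum_i a i *: v i.

End Operators.

Section SequenceClasses.
Context {K : numFieldType}.

Definition linfty_norm (E : completeNormedModType K) (x : nat -> E) : K :=
  supremum 0 (range (fun n => `|x n|)).

Definition is_spread (E : completeNormedModType K)
    (n : nat -> nat) (x y : nat -> E) : Prop :=
  (forall i, y (n i) = x i) /\ (forall j, ~ range n j -> y j = 0).

End SequenceClasses.

(** The constants (of the quasi-norms and of [seqs_linfty]) may depend on
    [E]. *)
Record standardSequenceClass (K : numFieldType) := {
  seqs :> forall E : completeNormedModType K, quasiBanachSubspace (nat -> E);
  seqs_c00 : forall (E : completeNormedModType K) (x : nat -> E),
    (\forall n \near \oo, x n = 0) -> seqs E x;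
  seqs_linfty : forall E : completeNormedModType K, exists2 C : K, 0 < C &
    forall x, seqs E x -> bounded_fun x /\
      linfty_norm x <= C * qnorm (seqs E) x;
  seqs_subseq : forall (E : completeNormedModType K) (x : nat -> E)
      (n : nat -> nat), {homo n : i j / (i < j)%N} -> seqs E x ->
    seqs E (x \o n) /\ qnorm (seqs E) (x \o n) <= qnorm (seqs E) x;
  seqs_spread : forall (E : completeNormedModType K) (x y : nat -> E)
      (n : nat -> nat), {homo n : i j / (i < j)%N} -> is_spread n x y ->
    seqs E x -> seqs E y /\ qnorm (seqs E) y <= qnorm (seqs E) x
}.

(** A standard sequence space [Z(G)] that is a Banach space: its quasi-norm is
    a norm. *)
Record banachSequenceSpace (K : numFieldType) := {
  bss_class : standardSequenceClass K;
  bss_base : completeNormedModType K;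
  bss_norm : triangle_inequality (bss_class bss_base)
}.

Definition bss_space (K : numFieldType) (S : banachSequenceSpace K) :
  completeNormedModType K := banach_subspace_normedType (@bss_norm K S).
Coercion bss_space : banachSequenceSpace >-> CompleteNormedModule.type.

Section Summing.
Context {K : numFieldType} (X Y : standardSequenceClass K).

Definition summing (E F : completeNormedModType K) (u : E -> F) : Prop :=
  bounded_linear u /\ forall x : nat -> E, X E x -> Y F (u \o x).

End Summing.
Arguments summing {K} X Y E F u.

Definition linearly_stable (K : numFieldType) (Y : standardSequenceClass K) :=
  forall (E F : completeNormedModType K) (T : E -> F),
    summing Y Y E F T <-> bounded_linear T.

Variant scalarKind := RealScalars | ComplexScalars.

Definition scalars (R : realType) (s : scalarKind) : numFieldType :=
  match s with RealScalars => R | ComplexScalars => R[i] end.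

Section ComplexComplete.
Local Open Scope complex_scope.
Variable R : realType.
Let C : numFieldType := R[i].

Lemma complex_complete (F : set_system C^o) :
  ProperFilter F -> cauchy F -> cvg F.
Proof.
move=> FF /cauchy_ballP Fc.
have e_real (e : C) : 0 < e -> exists2 r : R, 0 < r & e = r%:C.
  move=> e0; exists (complex.Re e); last by rewrite RRe_real// gtr0_real.
  by move: e0; rewrite ltcE => /andP[].
have ReF : cauchy ((@complex.Re R : C^o -> R) @ F).
  apply/cauchy_ballP => e e0; have e0' : 0 < e%:C :> C by rewrite ltcR.
  have [[A B] /= [FA FB] AB] := Fc _ e0'.
  exists (@complex.Re R @` A, @complex.Re R @` B) => /=.
    by split; [apply: filterS FA|apply: filterS FB] => x ?; exists x.
  move=> [_ _] [/= [x Ax <-] [y By <-]].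
  have := AB (x, y) (conj Ax By); rewrite /= -!ball_normE /=.
  rewrite -raddfB -ltcR; apply: le_lt_trans; exact: (normc_ge_Re (x - y)).
have normc_ge_Im (x : C) : `|complex.Im x|%:C <= `|x|.
  by rewrite normc_def lecR -sqrtr_sqr ler_wsqrtr// lerDr sqr_ge0.
have ImF : cauchy ((@complex.Im R : C^o -> R) @ F).
  apply/cauchy_ballP => e e0; have e0' : 0 < e%:C :> C by rewrite ltcR.
  have [[A B] /= [FA FB] AB] := Fc _ e0'.
  exists (@complex.Im R @` A, @complex.Im R @` B) => /=.
    by split; [apply: filterS FA|apply: filterS FB] => x ?; exists x.
  move=> [_ _] [/= [x Ax <-] [y By <-]].
  have := AB (x, y) (conj Ax By); rewrite /= -!ball_normE /=.
  rewrite -raddfB -ltcR; apply: le_lt_trans; exact: (normc_ge_Im (x - y)).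
have /cvg_ex[a Fa] := R_complete (fmap_proper_filter _ FF) ReF.
have /cvg_ex[b Fb] := R_complete (fmap_proper_filter _ FF) ImF.
apply/cvg_ex; exists ((a +i* b) : C^o).
apply/cvgrPdist_lt => _ /e_real[r r0 ->].
have r2 : 0 < r / 2 by rewrite divr_gt0.
move/cvgrPdist_lt : Fa => /(_ _ r2) Fa.
move/cvgrPdist_lt : Fb => /(_ _ r2) Fb.
near=> z.
have za : `|a - complex.Re z| < r / 2 by near: z; exact: Fa.
have zb : `|b - complex.Im z| < r / 2 by near: z; exact: Fb.
have -> : (a +i* b : C) - z =
    (a - complex.Re z)%:C + 'i%C * (b - complex.Im z)%:C.
  by case: (z) => c d; simpc.
rewrite (le_lt_trans (ler_normD _ _))// normrM (_ : `|'i%C : C| = 1);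
  last by rewrite normc_def /= expr0n expr1n add0r sqrtr1.
have normR (x : R) : `|x%:C : C| = (`|x|)%:C.
  by rewrite normc_def /= expr0n addr0 sqrtr_sqr.
rewrite mul1r !normR -rmorphD ltcR [ltRHS]splitr; exact: ltrD.
Unshelve. all: by end_near. Qed.

End ComplexComplete.

Definition scalar_space (R : realType) (s : scalarKind) :
    completeNormedModType (scalars R s) :=
  match s with
  | RealScalars => R^o
  | ComplexScalars => HB.pack_for (completeNormedModType R[i]) (R[i]^o)
      (Uniform_isComplete.Build R[i]^o (@complex_complete R))
  end.

Record quasiBanachIdeal (R : realType) (s : scalarKind) := {
  ideal :> forall E F : completeNormedModType (scalars R s),
    quasiBanachSubspace (E -> F);
  ideal_bounded : forall (E F : completeNormedModType (scalars R s))
      (T : E -> F), ideal E F T -> bounded_linear T;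
  ideal_finite_rank : forall (E F : completeNormedModType (scalars R s))
      (T : E -> F),
    bounded_linear T -> finite_rank T -> ideal E F T;
  ideal_comp : forall (E E0 F0 F : completeNormedModType (scalars R s))
      (u : E -> E0) (T : E0 -> F0) (v : F0 -> F),
    bounded_linear u -> ideal E0 F0 T -> bounded_linear v ->
    ideal E F (v \o T \o u) /\
    qnorm (ideal E F) (v \o T \o u) <=
      opnorm v * qnorm (ideal E0 F0) T * opnorm u;
  ideal_id : qnorm (ideal (scalar_space R s) (scalar_space R s)) id = 1
}.

Section Spaceability.
Context {K : numFieldType}.

Definition linear_subspace (V : lmodType K) (W : set V) : Prop :=
  W 0 /\ forall (a : K) x y, W x -> W y -> W (a *: x + y).

Definition lin_span (V : lmodType K) (B : set V) : set V :=
  [set x | exists n (b : 'I_n -> V) (a : 'I_n -> K),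
    (forall i, B (b i)) /\ x = \sum_i a i *: b i].

Definition lin_independent (V : lmodType K) (B : set V) : Prop :=
  forall n (b : 'I_n -> V) (a : 'I_n -> K),
    injective b -> (forall i, B (b i)) -> \sum_i a i *: b i = 0 ->
    forall i, a i = 0.

Definition hamel_basis (V : lmodType K) (W B : set V) : Prop :=
  lin_independent B /\ lin_span B = W.

Definition continuum_dimensional (R : realType) (V : lmodType K) (W : set V) :=
  exists2 B : set V, hamel_basis W B & (B #= [set: R])%card.

Definition pointwise_continuum_spaceable (R : realType)
    (V : topologicalLmodType K) (A : set V) : Prop :=
  forall x, A x -> exists W : set V,
    [/\ linear_subspace W, closed W, continuum_dimensional R W, W x &
        W `<=` A `|` [set 0]].

End Spaceability.
Arguments continuum_dimensional {K} R {V} W.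
Arguments pointwise_continuum_spaceable {K} R {V} A.

(* Main.v *)
Require Import Defs.
From HB Require Import structures.
From mathcomp Require Import all_boot all_order all_algebra.
From mathcomp Require Import ring lra.
From mathcomp Require Import complex.
From mathcomp Require Import boolp classical_sets functions cardinality filter.
From mathcomp Require Import reals topology normedtype.

Set Implicit Arguments.
Unset Strict Implicit.
Unset Printing Implicit Defensive.

Import Order.TTheory GRing.Theory Num.Theory.
Import numFieldNormedType.Exports.

Local Open Scope classical_set_scope.
Local Open Scope ring_scope.

(** Partition [nat] into infinite blocks [N_0, N_1, ...], where [N_0] is the set
    of the even or of the odd numbers.  Let [P_k] be the restriction of a
    sequence to [N_k], reindexed by [nat], and [S_k] the spreading of a sequence
    along [N_k]; both are contractions of the sequence space.  Let [T] be in the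
    ideal but not summing.  By linear stability, [N_0] can be chosen such that
    [U = P_0 T] is not summing either.  The subspace
      [M = {x | P_0 x = c U and each P_k (x - c T), k > 0, is a multiple of U}]
    contains [T]; it is closed since [P_k] is continuous and lines are closed.
    If [x] in [M] is not [0], then some [P_k x] is a nonzero multiple of [U], so
    [x] is not summing.  For small scalars [r] the sums [\sum_k r^k S_(k+1) U]
    converge even for a quasi-norm, lie in [M], and are linearly independent by
    Vandermonde, while [x] is determined by its sequence of multiples: the
    dimension of [M] is the continuum. *)

(** * Linear independence and Hamel bases *)

(** A relation involves finitely many vectors, so a single member of the chain contains those
    outside [B0]. This is the chain condition for Zorn's lemma. *)
Lemma lin_independent_bigcup (K : numFieldType) (V : lmodType K) (B0 : set V)
    (F : set (set V)) :
  lin_independent B0 -> total_on F subset ->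
  (forall X, F X -> lin_independent (B0 `|` X)) ->
  lin_independent (B0 `|` \bigcup_(X in F) X).
Proof.
move=> B0free Ftot Ffree n b a b_inj Bb ab0.
(* Induction on the number of vectors treated; the second alternative covers an empty chain. *)
have sub k : (exists2 X, F X & forall i : 'I_n, (i < k)%N -> (B0 `|` X) (b i))
    \/ (forall i : 'I_n, (i < k)%N -> B0 (b i)).
  elim: k => [|k IH]; first by right.
  have [nk|kn] := leqP n k.
    by case: IH => [[X FX h]|h]; [left; exists X => //|right] => i _;
      apply: h; exact: leq_trans nk.
  have split_lt (P : 'I_n -> Prop) : P (Ordinal kn) ->
      (forall i : 'I_n, (i < k)%N -> P i) ->
      forall i : 'I_n, (i < k.+1)%N -> P i.
    move=> Pk Pi i; rewrite ltnS leq_eqVlt => /orP[/eqP ik|/Pi//].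
    by rewrite (_ : i = Ordinal kn)//; exact: val_inj.
  case: (Bb (Ordinal kn)) => [Bk|[Y FY Yk]].
    case: IH => [[X FX h]|h].
      by left; exists X => //; apply: split_lt => //; left.
    by right; apply: split_lt.
  left; case: IH => [[X FX h]|h]; last first.
    exists Y => //; apply: split_lt; first by right.
    by move=> i /h; left.
  case: (Ftot _ _ FX FY) => XY.
    exists Y => //; apply: split_lt; first by right.
    by move=> i /h; apply: setUS.
  by exists X => //; apply: split_lt => //; right; exact: XY.
case: (sub n) => [[X FX h]|h].
  by apply: (Ffree X FX n b a) => // i; exact: h.
by apply: (B0free n b a) => // i; exact: h.
Qed.

Lemma lin_independentU1 (K : numFieldType) (V : lmodType K) (B : set V)
    (w : V) :
  lin_independent B -> ~ lin_span B w -> lin_independent (B `|` [set w]).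
Proof.
move=> Bfree wB n b a b_inj Bb ab0.
have [[i0 bi0]|nw] := pselect (exists i, b i = w); last first.
  apply: (Bfree n b a) => // i; case: (Bb i) => // bi.
  by exfalso; apply: nw; exists i.
case: n i0 => [[]//|n] i0 in b a b_inj Bb ab0 bi0 *.
have Blift j : B (b (lift i0 j)).
  case: (Bb (lift i0 j)) => // /=; rewrite -bi0 => /b_inj /eqP.
  by rewrite eq_sym (negbTE (neq_lift _ _)).
rewrite (bigD1_ord i0)//= bi0 in ab0.
(* With a nonzero coefficient, the relation could be solved for [w], placing it in the span of
   [B]. *)
have a0 : a i0 = 0.
  apply/eqP/negP => /negP a0; apply: wB.
  exists n, (b \o lift i0), (fun j => - (a i0)^-1 * a (lift i0 j)); split=> //.
  move/eqP: ab0; rewrite addr_eq0 => /eqP /(congr1 (fun v => (a i0)^-1 *: v)).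
  rewrite scalerA mulVf// scale1r => ->; rewrite scalerN -scaleNr scaler_sumr.
  by apply: eq_bigr => j _; rewrite scalerA.
rewrite a0 scale0r add0r in ab0.
move=> i; case: (unliftP i0 i) => [j ->|->//].
by apply: (Bfree n (b \o lift i0) (a \o lift i0)) => // x y /b_inj/lift_inj.
Qed.

Lemma lin_span_sub (K : numFieldType) (V : lmodType K) (B W : set V) :
  linear_subspace W -> B `<=` W -> lin_span B `<=` W.
Proof.
move=> [W0 WP] BW _ [n [b [a [Bb ->]]]].
elim: n b a Bb => [|n IH] b a Bb; first by rewrite big_ord0.
by rewrite big_ord_recl; apply: WP; [exact: BW|apply: IH => i].
Qed.

Lemma hamel_basis_extension (K : numFieldType) (V : lmodType K) (B0 W : set V) :
  linear_subspace W -> B0 `<=` W -> lin_independent B0 ->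
  exists2 B, B0 `<=` B & hamel_basis W B.
Proof.
move=> Wlin B0W B0free.
(* [X] collects only the added vectors and need not contain [B0], so that the empty union is
   admissible. *)
pose P := [set X : set V | X `<=` W /\ lin_independent (B0 `|` X)].
have [F FP Ftot|X [[XW Xfree] Xmax]] := @Zorn_bigcup _ P.
  split; first by apply: bigcup_sub => X /FP[].
  by apply: lin_independent_bigcup => // X /FP[].
exists (B0 `|` X); first exact: subsetUl.
split=> //; apply/seteqP; split.
  by apply: lin_span_sub => //; rewrite subUset.
move=> w Ww; apply: contrapT => wB.
apply: (Xmax (X `|` [set w])).
  split; first exact: subsetUl.
  move=> h; apply: wB; exists 1%N, (fun=> w), (fun=> 1); split=> [_|].
    by right; apply: h; right.
  by rewrite big_ord1 scale1r.
split; first by rewrite subUset; split=> // _ ->.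
by rewrite setUA; exact: lin_independentU1.
Qed.

(* Evaluating the relation at the Lagrange polynomials of the nodes [t i]. *)
Lemma vandermonde_free (K : idomainType) n (t b : 'I_n -> K) :
  injective t -> (forall k, \sum_i b i * t i ^+ k = 0) -> forall i, b i = 0.
Proof.
move=> t_inj bt i.
have bp (p : {poly K}) : \sum_i b i * p.[t i] = 0.
  under eq_bigr do rewrite horner_coef mulr_sumr.
  rewrite exchange_big big1//= => k _.
  under eq_bigr do rewrite mulrCA.
  by rewrite -mulr_sumr bt mulr0.
have := bp (\prod_(j | j != i) ('X - (t j)%:P)).
rewrite (bigD1 i)//= [X in _ + X]big1 => [|j ji]; last first.
  by rewrite horner_prod (bigD1 j)//= hornerXsubC subrr mul0r mulr0.
rewrite addr0 => /eqP; rewrite mulf_eq0 => /orP[/eqP//|].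
rewrite horner_prod => /eqP/eqP; rewrite prodf_seq_eq0 => /hasP[j _ /andP[ji]].
by rewrite hornerXsubC subr_eq0 => /eqP/t_inj ij; rewrite ij eqxx in ji.
Qed.

(** * Injections bounding cardinalities by the continuum *)

Lemma real_setQ_inj (R : realType) :
  exists f : R -> set rat, injective f.
Proof.
exists (fun x => [set q | ratr q < x]) => x y xy.
wlog lt_xy : x y xy / x < y.
  move=> h; case: (ltgtP x y) => // [/h|yx]; first exact.
  by apply/esym/h.
have [q] := rat_in_itvoo lt_xy.
rewrite in_itv /= => /andP[xq qy].
have : [set q | ratr q < y] q by [].
by rewrite -xy /= ltNge (ltW xq).
Qed.

(** Base 3 expansion with digits 0 and 1: at the first index [m] where two sets differ, the digit
    counts [3^-m], while all later digits together count at most half of that. *)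
Lemma set_nat_real_inj (R : realType) :
  exists f : set nat -> R, injective f.
Proof.
pose s (A : set nat) n : R := \sum_(k < n) `[< A k >]%:R * 3^-1 ^+ k.
have sS A n : s A n.+1 = s A n + `[< A n >]%:R * 3^-1 ^+ n.
  by rewrite /s big_ord_recr.
have q_ge0 n : 0 <= 3^-1 ^+ n :> R by rewrite exprn_ge0// invr_ge0.
(* The subtracted term is the exact remainder of the geometric series, which makes the induction go
   through. *)
have s_tail A m n : s A (m + n)%N <=
    s A m + 3^-1 ^+ m * 3 / 2 - 3^-1 ^+ (m + n) * 3 / 2.
  elim: n => [|n IH]; first by rewrite addn0 addrK.
  rewrite addnS sS exprS.
  have : `[< A (m + n)%N >]%:R * 3^-1 ^+ (m + n) <= 3^-1 ^+ (m + n) :> R.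
    by case: `[< _ >]; rewrite (mul1r, mul0r).
  move: IH; lra.
have s_mono A m n : s A m <= s A (m + n)%N.
  elim: n => [|n IH]; first by rewrite addn0.
  by rewrite addnS sS (le_trans IH)// lerDl mulr_ge0.
pose f A := sup (range (s A)).
have s_ub A m : ubound (range (s A)) (s A m + 3^-1 ^+ m * 3 / 2).
  move=> _ [n _ <-]; apply: (le_trans (s_mono A n m)); rewrite addnC.
  by apply: (le_trans (s_tail A m n)); rewrite gerBl !mulr_ge0// invr_ge0.
have f_ge A m : s A m <= f A.
  by apply: ub_le_sup; [exists (s A 0%N + 3^-1 ^+ 0 * 3 / 2)|exists m].
have f_le A m : f A <= s A m + 3^-1 ^+ m * 3 / 2.
  by apply: ge_sup => //; exists (s A 0%N); exists 0%N.
have f_lt A B m : (forall k, (k < m)%N -> A k = B k) -> A m -> ~ B m ->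
    f B < f A.
  move=> AB Am Bm; have sAB : s A m = s B m.
    by apply: eq_bigr => k _; rewrite AB.
  have := f_ge A m.+1; have := f_le B m.+1.
  rewrite !sS sAB (asboolT Am) (asboolF Bm) exprS mulr0n mul0r mul1r.
  have : 0 < 3^-1 ^+ m :> R by rewrite exprn_gt0// invr_gt0.
  lra.
exists f => A B fAB; apply: contrapT => AB.
have exk : exists k, `[< A k <> B k >].
  apply: contra_notP AB => h; apply/funext => k; apply: contrapT => ABk.
  by apply: h; exists k; exact/asboolP.
case: (ex_minnP exk) => m /asboolP ABm mmin.
have {}mmin j : (j < m)%N -> A j = B j.
  by move=> jm; apply: contrapT => /asboolP/mmin; rewrite leqNgt jm.
have [Am|Am] := pselect (A m); have [Bm|Bm] := pselect (B m).
- by apply: ABm; apply/propext.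
- by have := f_lt _ _ _ mmin Am Bm; rewrite fAB ltxx.
- have := f_lt B A m _ Bm Am; rewrite fAB ltxx => h.
  by apply: notF; apply: h => j /mmin.
- by apply: ABm; apply/propext.
Qed.

Lemma set_countType_real_inj (R : realType) (T : countType) :
  exists f : set T -> R, injective f.
Proof.
have [f f_inj] := set_nat_real_inj R.
exists (fun A => f (pickle @` A)) => A B /f_inj AB; apply/seteqP.
split=> x Ax.
  have : (pickle @` B) (pickle x) by rewrite -AB; exists x.
  by move=> [y By] /(pcan_inj pickleK) <-.
have : (pickle @` A) (pickle x) by rewrite AB; exists x.
by move=> [y By] /(pcan_inj pickleK) <-.
Qed.

(** Coding each entry by [g] turns a sequence into a subset of the countable type
    [nat * (rat * bool)], hence into a real number. *)
Lemma card_le_real_sequences (R : realType) (T C : Type) (W : set T)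
    (c : T -> nat -> C) (g : C -> set (rat * bool)) :
  injective g -> {in W &, injective c} -> (W #<= [set: R])%card.
Proof.
move=> g_inj c_inj.
have [f f_inj] := set_countType_real_inj R (nat * (rat * bool))%type.
apply/pcard_injP; exists (fun w => f [set x | g (c w x.1) x.2]).
move=> w w' Ww Ww' /f_inj cww'.
apply: c_inj => //; apply/funext => n; apply: g_inj; apply/funext => x.
by have := congr1 (fun A : set _ => A (n, x)) cww'.
Qed.

(** * Completeness, small elements and cardinality of the scalar fields *)

Lemma scalars_complete (R : realType) (s : scalarKind)
    (F : set_system (scalars R s)^o) : ProperFilter F -> cauchy F -> cvg F.
Proof. by case: s F => F; [exact: R_complete|exact: complex_complete]. Qed.

Lemma exp_half_lt_real (R : realType) (e : R) :
  0 < e -> exists m, 2^-1 ^+ m < e.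
Proof.
move=> e0; exists (Num.truncn e^-1).+1.
rewrite exprVn invf_plt ?posrE ?exprn_gt0//.
rewrite (lt_trans (truncnS_gt _))// -natrX ltr_nat.
exact: ltn_expl.
Qed.

Lemma exp_half_lt (R : realType) (s : scalarKind) (e : scalars R s) :
  0 < e -> exists m, 2^-1 ^+ m < e.
Proof.
case: s e => /= e; first exact: exp_half_lt_real.
(* Positivity in [R[i]] forces the imaginary part to vanish, which reduces to the real case. *)
case: e => a b; rewrite ltcE /= => /andP[/eqP -> a0].
have [m ma] := exp_half_lt_real a0; exists m.
have -> : Complex a 0 = real_complex R a by [].
have <- : real_complex R (2^-1 ^+ m) = 2^-1 ^+ m.
  by rewrite rmorphXn fmorphV rmorph_nat.
by rewrite ltcR.
Qed.

(** For complex scalars the boolean selects the real or the imaginary part; both fields thus have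
    codes of the same type. *)
Lemma scalars_set_inj (R : realType) (s : scalarKind) :
  exists g : scalars R s -> set (rat * bool), injective g.
Proof.
have [g g_inj] := real_setQ_inj R.
case: s => /=.
  exists (fun x => [set p | g x p.1]) => x y xy; apply/g_inj/funext => q.
  by have := congr1 (fun A : set _ => A (q, true)) xy.
exists (fun x => [set p | g (if p.2 then complex.Re x else complex.Im x) p.1]).
move=> [a b] [c d] xy; congr Complex; apply/g_inj/funext => q.
  by have := congr1 (fun A : set _ => A (q, true)) xy.
by have := congr1 (fun A : set _ => A (q, false)) xy.
Qed.

Lemma real_inj_unit_interval (R : realType) :
  exists2 h : R -> R, injective h & forall r, 0 < h r < 1.
Proof.
(* The nonnegative reals go into []0, 1/2]] and the negative ones into []1/2, 1[]. *)
exists (fun r => if 0 <= r then (r + 2)^-1 else 1 - (2 - r)^-1); last first.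
  move=> r; case: (leP 0 r) => r0.
    by rewrite invr_gt0 invf_lt1; lra.
  by rewrite subr_gt0 invf_lt1 ?ltrBlDr ?ltrDl ?invr_gt0; lra.
have low r : 0 <= r -> (r + 2)^-1 <= 2^-1 :> R.
  by move=> r0; rewrite lef_pV2 ?posrE; lra.
have high r : r < 0 -> 2^-1 < 1 - (2 - r)^-1 :> R.
  move=> r0; have : (2 - r)^-1 < 2^-1 by rewrite ltf_pV2 ?posrE; lra.
  lra.
move=> x y; case: leP => x0; case: leP => y0.
- by move/invr_inj/addIr.
- by move=> xy; have := low _ x0; have := high _ y0; rewrite xy; lra.
- by move=> xy; have := low _ y0; have := high _ x0; rewrite xy; lra.
- by move/addrI/oppr_inj/invr_inj/addrI/oppr_inj.
Qed.

Lemma real_inj_ball (R : realType) (s : scalarKind) (d : scalars R s) :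
  0 < d -> exists2 g : R -> scalars R s, injective g & forall r, `|g r| < d.
Proof.
have [h h_inj h01] := real_inj_unit_interval R.
have [i i_inj i1] : exists2 i : R -> scalars R s, injective i &
    forall r, 0 < r < 1 -> `|i r| < 1.
  case: s {d}.
    by exists id => // r /andP[r0 r1]; rewrite gtr0_norm.
  exists (real_complex R) => [|r /andP[r0 r1]]; first exact: complexI.
  by rewrite gtr0_norm ?ltcR//= (ltcR r 1).
move=> d0; exists (fun r => d * i (h r)).
  by move=> x y /(mulfI (lt0r_neq0 d0))/i_inj/h_inj.
by move=> r; rewrite normrM gtr0_norm// gtr_pMr// i1.
Qed.

(** * Closed lines and geometric series in quasi-normed spaces *)

Section QuasiNorm.
Context {K : numFieldType} {V : lmodType K} (W : quasiNormedSubspace V).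
Local Notation N := (@qspace_norm K V W).

Lemma qspace_small_eq0 (x : qspace W) : (forall e, 0 < e -> N x < e) -> x = 0.
Proof.
move=> h; apply: qspace_eq0; apply/eqP/negP => /negP x0.
by have := h (N x); rewrite ltxx lt_def x0 qspace_ge0 => /(_ isT).
Qed.

Lemma qspace_norm_gt0 (x : qspace W) : x <> 0 -> 0 < N x.
Proof.
by move=> x0; rewrite lt_def qspace_ge0 andbT; apply/eqP => /qspace_eq0.
Qed.

(** The scalars [a] with [a *: u] close to [v] generate a filter. It is Cauchy because distances on
    the line are those of the scalars times [N u > 0], and its limit is the coefficient sought. *)
Lemma closed_line (u v : qspace W) :
  (forall F : set_system K^o, ProperFilter F -> cauchy F -> cvg F) ->
  u <> 0 -> (forall e, 0 < e -> exists a, N (v - a *: u) < e) ->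
  exists a, v = a *: u.
Proof.
move=> Kcomplete /qspace_norm_gt0 u0 uv.
pose F : set_system K^o :=
  [set A | exists2 e, 0 < e & [set a | N (v - a *: u) < e] `<=` A].
have FF : ProperFilter F.
  split; first by move=> [e /uv[a va] /(_ _ va)].
  split=> /=; first by exists 1.
    move=> A B [e e0 eA] [d d0 dB].
    have ed : (e >=< d)%O by apply: real_comparable; exact: gtr0_real.
    exists (Num.min e d); first by rewrite comparable_lt_min// e0.
    by move=> a /=; rewrite comparable_lt_min// => /andP[/eA ? /dB].
  by move=> A B AB [e e0 eA]; exists e => //; exact: subset_trans AB.
have Fc : cauchy F.
  apply/cauchy_ballP => e e0.
  have [d d0 h] := qspace_normD_lt W (mulr_gt0 e0 u0).
  exists ([set a | N (v - a *: u) < d], [set a | N (v - a *: u) < d]).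
    by split; exists d.
  move=> [a b] [/= va vb]; rewrite -ball_normE /=.
  rewrite -(ltr_pM2r u0) -qspace_normZ.
  have -> : (a - b) *: u = (v - b *: u) + - (v - a *: u).
    by rewrite scalerBl opprB [RHS]addrC addrA subrK.
  by apply: h => //; rewrite qspace_normN.
have /cvg_ex[/= a Fa] := Kcomplete F FF Fc.
exists a; apply/subr0_eq/qspace_small_eq0 => e /(qspace_normD_lt W)[d d0 h].
have vF : F [set a | N (v - a *: u) < d] by exists d.
have aF := Fa _ (nbhsx_ballx a _ (divr_gt0 d0 u0)).
have [b [/= vb]] := filter_ex (filterI vF aF).
rewrite -ball_normE /= => ab.
have -> : v - a *: u = (v - b *: u) + (b - a) *: u.
  by rewrite scalerBl addrA subrK.
apply: h => //.
by rewrite qspace_normZ distrC -ltr_pdivlMr.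
Qed.

(** Splitting off the first term costs one factor [k], which [k * r <= 1/2] absorbs:
    [k * (C * r^m + 2 * k * C * r^(m+1))] is [k * C * r^m * (1 + 2 * (k * r))], at most
    [2 * k * C * r^m]. *)
Lemma qspace_sum_geometric (k C r : K) (v : nat -> qspace W) :
  (forall x y, N (x + y) <= k * (N x + N y)) -> 0 <= k -> 0 <= C -> 0 <= r ->
  k * r <= 2^-1 -> (forall i, N (v i) <= C * r ^+ i) ->
  forall m n, N (\sum_(m <= i < m + n) v i) <= 2 * k * C * r ^+ m.
Proof.
move=> kN k0 C0 r0 kr vC m n.
have c0 : 0 <= 2 * k * C by rewrite !mulr_ge0.
elim: n m => [|n IH] m.
  by rewrite addn0 big_geq// qspace_norm0 mulr_ge0// exprn_ge0.
rewrite big_ltn ?addnS ?ltnS ?leq_addr// -addSn.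
apply: (le_trans (kN _ _)).
apply: (@le_trans _ _ (k * (C * r ^+ m + 2 * k * C * r ^+ m.+1))).
  by rewrite ler_wpM2l// lerD.
rewrite exprS.
have -> : k * (C * r ^+ m + 2 * k * C * (r * r ^+ m)) =
  k * C * r ^+ m * (1 + 2 * (k * r)) by ring.
have -> : 2 * k * C * r ^+ m = k * C * r ^+ m * 2 by ring.
rewrite ler_wpM2l ?mulr_ge0 ?exprn_ge0//.
by rewrite -[leRHS]/(1 + 1) lerD2l -ler_pdivlMl// mulr1.
Qed.

End QuasiNorm.

Section QuasiBanach.
Context {R : realType} {s : scalarKind} {V : lmodType (scalars R s)}.
Context (W : quasiBanachSubspace V).
Local Notation K := (scalars R s).
Local Notation N := (@qspace_norm K V W).

Lemma qspace_geometric_series :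
  exists2 d : K, 0 < d & forall (r C : K) (v : nat -> qspace W),
    0 <= r -> r <= d -> (forall i, N (v i) <= C * r ^+ i) ->
    exists x, forall e, 0 < e -> exists m, forall n, (m <= n)%N ->
      N (x - \sum_(0 <= i < n) v i) < e.
Proof.
have [k k1 kN] := qspace_normD W.
have k0 : 0 < k by exact: lt_le_trans k1.
(* This gives [k * r <= 1/2], and also [r <= 1/2] since [1 <= k]. *)
exists (k^-1 * 2^-1); first by rewrite mulr_gt0 ?invr_gt0.
move=> r C v r0 rd vC.
have C0 : 0 <= C.
  by have := vC 0%N; rewrite expr0 mulr1; apply: le_trans; exact: qspace_ge0.
have kr : k * r <= 2^-1 by rewrite mulrC -ler_pdivlMr// mulrC.
have r2 : r <= 2^-1.
  by apply: le_trans kr; rewrite ler_peMl.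
pose S n := \sum_(0 <= i < n) v i.
have Stail e : 0 < e -> exists m, forall n, (m <= n)%N -> N (S n - S m) < e.
  move=> e0; have c0 : 0 < 2 * k * C + 1 by rewrite ltr_wpDl// !mulr_ge0// ltW.
  have [m me] := exp_half_lt (divr_gt0 e0 c0); exists m => n mn.
  rewrite /S (big_cat_nat (leq0n m) mn)//= addrAC subrr add0r -(subnKC mn).
  apply: (le_lt_trans (qspace_sum_geometric kN (ltW k0) C0 r0 kr vC m _)).
  apply: (@le_lt_trans _ _ ((2 * k * C + 1) * 2^-1 ^+ m)).
    by rewrite ler_pM ?exprn_ge0 ?lerDl
       ?lerXn2r ?nnegrE ?mulr_ge0 ?invr_ge0// ltW.
  by rewrite mulrC -ltr_pdivlMr.
have Sc : cauchy (S @ \oo).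
  move=> A [e e0 eA]; have [d d0 h] := qspace_normD_lt W e0.
  have [m mS] := Stail _ d0.
  exists ([set x | N (x - S m) < d], [set x | N (x - S m) < d]).
    by split; exists m => // n /= /mS.
  move=> [x y] [/= xm ym]; apply: eA => /=.
  have -> : x - y = (x - S m) + - (y - S m) by rewrite opprB addrA subrK.
  by apply: h => //; rewrite qspace_normN.
have Scvg : cvg (S @ \oo) by exact: (@qb_complete _ _ W).
move/cvg_ex: Scvg => [/= x Sx].
exists x => e e0.
have [m _ mS] : (S @ \oo) [set y | N (x - y) < e].
  by apply: Sx; apply/qspace_nbhsP; exists e.
by exists m => n mn; exact: mS.
Qed.

(** * The subspace of blockwise multiples *)

(** [p k] models restriction to block [k], [t] the given operator, and [e k] the spreading of [u]
    along block [k.+1]. *)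
Context (p : nat -> {linear qspace W -> qspace W}) (t u : qspace W).
Context (e : nat -> qspace W).
Context (p_contr : forall k x, N (p k x) <= N x).
Context (p_separating : forall x, (forall k, p k x = 0) -> x = 0).
Context (p0t : p 0 t = u).
Context (u_neq0 : u <> 0).
Context (p0e : forall k, p 0 (e k) = 0).
Context (pSe : forall j k, p j.+1 (e k) = (j == k)%:R *: u).
Context (e_bound : forall k, N (e k) <= N u).

(** Block 0 fixes [c]; subtracting [c *: t] before testing the other blocks admits [t], whose
    restrictions there are arbitrary. *)
Definition blockwise_multiples : set (qspace W) :=
  [set x | exists c, p 0 x = c *: u /\
    forall k, exists a, p k.+1 (x - c *: t) = a *: u].
Local Notation M := blockwise_multiples.

Lemma blockwise_multiples_subspace : linear_subspace M.
Proof.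
split.
  exists 0; rewrite linear0 scale0r; split=> // k; exists 0.
  by rewrite !scale0r subrr linear0.
move=> a x y [c [xc xa]] [d [yd yb]]; exists (a * c + d); split.
  by rewrite linearP xc yd scalerDl scalerA.
move=> k; have [a1 xk] := xa k; have [b1 yk] := yb k.
exists (a * a1 + b1).
have -> : a *: x + y - (a * c + d) *: t = a *: (x - c *: t) + (y - d *: t).
  by rewrite scalerDl opprD addrACA scalerBr scalerA.
by rewrite linearP xk yk scalerDl scalerA.
Qed.

Lemma blockwise_multiples_closed : closed M.
Proof.
move=> x xM.
have line := closed_line (scalars_complete (R := R) (s := s)) u_neq0.
have u0 : 0 < N u by exact: qspace_norm_gt0.
have near_x d : 0 < d -> exists2 y, M y & N (x - y) < d.
  move=> d0; have [|y [My xy]] := xM [set y | N (x - y) < d].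
    by apply/qspace_nbhsP; exists d.
  by exists y.
have [c xc] : exists c, p 0 x = c *: u.
  apply: line => d /near_x[y [c [yc _]] xy]; exists c.
  by rewrite -yc -linearB; exact: le_lt_trans (p_contr _ _) xy.
exists c; split=> // k; apply: line => d d0.
have [d1 d10 h1] := qspace_normD_lt W d0.
have t1 : 0 < N t + 1 by rewrite ltr_wpDl// qspace_ge0.
have d20 : 0 < d1 / (N t + 1) * N u by rewrite mulr_gt0// divr_gt0.
(* The first bound controls [x - y]. The second, read on block 0 and divided by [N u], controls
   [c - c'] and hence [(c' - c) *: t]. *)
pose d2 := Num.min d1 (d1 / (N t + 1) * N u).
have d2c : (d1 >=< d1 / (N t + 1) * N u)%O.
  by apply: real_comparable; exact: gtr0_real.
have [|y [c' [yc ya]] xy] := near_x d2.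
  by rewrite comparable_lt_min// d10.
move: xy; rewrite comparable_lt_min// => /andP[xy1 xy2].
have [a ya'] := ya k; exists a; rewrite -ya' -linearB.
apply: (le_lt_trans (p_contr _ _)).
have -> : x - c *: t - (y - c' *: t) = (x - y) + (c' - c) *: t.
  by rewrite scalerBl opprB [RHS]addrACA [LHS]addrACA; congr +%R; exact: addrC.
apply: h1 => //; rewrite qspace_normZ distrC.
have cc : `|c - c'| < d1 / (N t + 1).
  rewrite -(ltr_pM2r u0) -qspace_normZ scalerBl -xc -yc -linearB.
  exact: le_lt_trans (p_contr _ _) xy2.
apply: (@le_lt_trans _ _ (`|c - c'| * (N t + 1))).
  by rewrite ler_wpM2l// lerDl.
by rewrite -ltr_pdivlMr.
Qed.

Lemma blockwise_multiples_gen : M t.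
Proof.
exists 1; rewrite !scale1r p0t; split=> // k; exists 0.
by rewrite subrr linear0 scale0r.
Qed.

Lemma blockwise_multiples_neq0 x : M x -> x <> 0 ->
  exists k a, a <> 0 /\ p k x = a *: u.
Proof.
move=> [c [xc xa]] x0; have [c0|c0] := eqVneq c 0; last first.
  by exists 0%N, c; split=> //; exact/eqP.
move: xc xa; rewrite c0 !scale0r => xc; rewrite subr0 => xa.
apply: contrapT => h; apply: x0; apply: p_separating => -[//|k].
have [a ak] := xa k; rewrite ak; have [->|a0] := eqVneq a 0.
  by rewrite scale0r.
by exfalso; apply: h; exists k.+1, a; split=> //; exact/eqP.
Qed.

Lemma scale_u_inj (a b : K) : a *: u = b *: u -> a = b.
Proof.
move=> /eqP; rewrite -subr_eq0 -scalerBl => /eqP ab; apply/eqP.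
rewrite -subr_eq0; apply/negP => /negP ab0; apply: u_neq0.
by rewrite -[u]scale1r -(mulVf ab0) -scalerA ab scaler0.
Qed.

Lemma blockwise_multiples_card_le : (M #<= [set: R])%card.
Proof.
have [g g_inj] := scalars_set_inj R s.
(* Index 0 stores [c] and index [k.+1] the coefficient on block [k.+1]; outside of [M] the sequence
   is a default. *)
have coefP x : exists a : nat -> K, M x ->
    p 0 x = a 0%N *: u /\ forall k, p k.+1 (x - a 0%N *: t) = a k.+1 *: u.
  have [[c [xc xa]]|?] := pselect (M x); last by exists (fun=> 0).
  have [b bP] := choice xa.
  by exists (fun k => if k is j.+1 then b j else c).
have [a aP] := choice coefP.
refine (card_le_real_sequences R (W := M) (c := a) g_inj _).
move=> x y /set_mem Mx /set_mem My xy.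
have [x0 xS] := aP _ Mx; have [y0 yS] := aP _ My.
apply/subr0_eq/p_separating => k.
(* The coefficients at index 0 agree, so the two multiples of [t] cancel. *)
have D : x - y = (x - a x 0%N *: t) - (y - a y 0%N *: t).
  by rewrite xy opprB addrA subrK.
case: k => [|k]; first by rewrite linearB x0 y0 xy subrr.
by rewrite D linearB xS yS xy subrr.
Qed.

(** The sum is that of [r ^+ i *: e i]. Each [p k] is eventually constant along the partial sums,
    and being a contraction it takes that same value at the limit. *)
Lemma geometric_block_sum : exists2 d : K, 0 < d &
  forall r : K, `|r| < d -> exists x,
    p 0 x = 0 /\ forall j, p j.+1 x = r ^+ j *: u.
Proof.
have [d d0 dP] := qspace_geometric_series; exists d => // r rd.
have [|x xP] := dP `|r| (N u) (fun i => r ^+ i *: e i) (normr_ge0 r) (ltW rd).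
  by move=> i; rewrite qspace_normZ normrX mulrC ler_wpM2r// exprn_ge0.
exists x.
have px_lim k v : (exists n0, forall n, (n0 <= n)%N ->
    p k (\sum_(0 <= i < n) r ^+ i *: e i) = v) -> p k x = v.
  move=> [n0 pn]; apply/subr0_eq/qspace_small_eq0 => b /xP[m mP].
  rewrite -(pn (maxn n0 m)) ?leq_maxl// -linearB.
  by apply: le_lt_trans (p_contr _ _) _; apply: mP; exact: leq_maxr.
split=> [|j]; apply: px_lim.
  exists 0%N => n _; rewrite linear_sum big1// => i _.
  by rewrite linearZ /= p0e scaler0.
exists j.+1 => n jn; rewrite linear_sum big_mkord (bigD1 (Ordinal jn))//=.
rewrite linearZ /= pSe eqxx scale1r big1 ?addr0// => i ij.
rewrite linearZ /= pSe (_ : (j == i) = false) ?scale0r ?scaler0//.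
by apply: contraNF ij => /eqP ij; apply/eqP/val_inj.
Qed.

Lemma blockwise_multiples_dim : continuum_dimensional R M.
Proof.
have [d d0 dP] := geometric_block_sum.
have [h h_inj hd] := real_inj_ball d0.
have [x xP] := choice (fun r => dP (h r) (hd r)).
(* The coefficient for [j = 1] is the ratio [h r] itself. *)
have x_inj : injective x.
  move=> r r' rr'; have := (xP r).2 1%N.
  by rewrite rr' (xP r').2 !expr1 => /scale_u_inj /h_inj.
have xM r : M (x r).
  exists 0; rewrite !scale0r subr0 (xP r).1; split=> // k.
  by exists (h r ^+ k); rewrite (xP r).2.
have x_free : lin_independent (range x).
  move=> n b a b_inj bx ab0.
  have bxr i : exists r, b i = x r by have [r _ <-] := bx i; exists r.
  have [r br] := choice bxr.
  (* Reading the relation on block [k.+1] gives the [k]-th power equation at the distinct nodes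
     [h (r i)]. *)
  apply: (@vandermonde_free _ _ (h \o r)) => [i j /h_inj ij|k].
    by apply: b_inj; rewrite !br ij.
  apply: scale_u_inj; rewrite scale0r -(linear0 (p k.+1)) -ab0 linear_sum.
  rewrite scaler_suml; apply: eq_bigr => i _.
  by rewrite linearZ /= br (xP _).2 scalerA.
have [|B xB MB] := hamel_basis_extension blockwise_multiples_subspace _ x_free.
  by move=> _ [r _ <-].
exists B => //; rewrite card_eq_le; apply/andP; split; last first.
  apply: card_le_trans (subset_card_le xB).
  by rewrite (card_le_eqr (inj_card_eq (in2W x_inj))).
apply: card_le_trans blockwise_multiples_card_le; apply: subset_card_le.
have [_ <-] := MB => b Bb; exists 1%N, (fun=> b), (fun=> 1); split=> //.
by rewrite big_ord1 scale1r.
Qed.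

End QuasiBanach.

(** * A partition of the natural numbers into infinite blocks *)

(* [block b 0] enumerates the numbers of parity [b] and the [block b k.+1]
   partition the others, according to the 2-adic valuation of [m./2.+1]. *)
Definition block (b : bool) (k i : nat) : nat :=
  (if k is j.+1 then ~~ b + (2 ^ j * i.*2.+1).-1.*2 else b + i.*2)%N.

Lemma block_homo b k : {homo block b k : i j / (i < j)%N}.
Proof.
case: k => [|k] i j ij /=; first by rewrite ltn_add2l ltn_double.
have k0 : (0 < 2 ^ k)%N by rewrite expn_gt0.
rewrite ltn_add2l ltn_double -(ltn_add2r 1) !addn1 !prednK ?muln_gt0 ?k0//.
by rewrite ltn_pmul2l// ltnS ltn_double.
Qed.

(** Parity separates block 0 from the others; among those, the 2-adic valuation recovers the block
    and the odd factor the position. *)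
Lemma block_inj b k i k' i' : block b k i = block b k' i' -> k = k' /\ i = i'.
Proof.
have q0 (j l : nat) : (0 < 2 ^ j * l.*2.+1)%N by rewrite muln_gt0 expn_gt0.
case: k k' => [|k] [|k'] /=.
- by move/addnI/double_inj.
- by move/(congr1 odd); rewrite !oddD !odd_double !addbF !oddb; case: b.
- by move/(congr1 odd); rewrite !oddD !odd_double !addbF !oddb; case: b.
move/addnI/double_inj/(congr1 succn); rewrite !prednK// => e.
have logE (j l : nat) : logn 2 (2 ^ j * l.*2.+1) = j.
  rewrite lognM ?expn_gt0// pfactorK// lognE/= dvdn2 /= odd_double addn0//.
have kk : k = k' by rewrite -(logE k i) e logE.
move: e; rewrite kk => /eqP; rewrite eqn_pmul2l ?expn_gt0// => /eqP[].
by move/double_inj.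
Qed.

Lemma block_surj b m : exists k i, block b k i = m.
Proof.
have [ob|ob] := boolP (odd m == b).
  by exists 0%N, m./2; rewrite /= -(eqP ob) odd_double_half.
(* The odd part [l] of [m./2.+1] yields the position [l./2], and the exponent of 2 the block. *)
have [l l2 lE] := pfactor_coprime (isT : prime 2) (isT : 0 < m./2.+1)%N.
exists (logn 2 m./2.+1).+1, l./2 => /=.
have lodd : odd l by rewrite -coprime2n.
have -> : l./2.*2.+1 = l by rewrite -[RHS]odd_double_half lodd.
rewrite mulnC -lE /= -[RHS]odd_double_half; congr (_ + _)%N.
by case: b (odd m) ob => [] [].
Qed.

(** * Restriction and spreading as operators on the sequence space and on the ideal *)

Lemma opnorm_contraction (K : numFieldType) (E F : completeNormedModType K)
    (v : E -> F) : v 0 = 0 -> (forall x, `|v x| <= `|x|) -> 0 <= opnorm v <= 1.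
Proof.
move=> v0 v1; rewrite /opnorm; set A := [set _ | _ in _].
have A1 : ubound A 1 by move=> _ [x /= x1 <-]; exact: le_trans (v1 x) x1.
have A0 : A 0 by exists 0; rewrite /= ?normr0// v0 normr0.
(* [supremum] takes the default value 0 when there is no least upper bound; every branch stays
   between 0 and 1. *)
rewrite /supremum; case: ifPn => _; first by rewrite lexx ler01.
case: xgetP => [y -> [yub ylb]|_]; last by rewrite lexx ler01.
by rewrite yub//= ylb.
Qed.

Section SequenceSpaceOperators.
Context {K : numFieldType} (S : banachSequenceSpace K).
Local Notation ZG := (bss_class S (bss_base S)).
Local Notation G := (bss_base S).

Definition bss_val (x : S) : nat -> G := @qspace_val _ _ ZG x.

Lemma bss_val_inj : injective bss_val.
Proof. by move=> x y xy; apply: (@val_inj _ _ (qspace ZG)). Qed.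

Lemma bss_valP (a : K) (x y : S) :
  bss_val (a *: x + y) = a *: bss_val x + bss_val y.
Proof. by []. Qed.

Definition bss_contraction (v : S -> S) : Prop :=
  linear v /\ forall x, `|v x| <= `|x|.

Lemma bss_contraction_exists (f : (nat -> G) -> nat -> G) : linear f ->
  (forall x, ZG x -> ZG (f x) /\ qnorm ZG (f x) <= qnorm ZG x) ->
  exists v : S -> S, bss_contraction v /\
    forall x, bss_val (v x) = f (bss_val x).
Proof.
move=> flin fZ.
have ZGval (x : S) : ZG (bss_val x) by exact: (@qspaceP _ _ ZG x).
pose v (x : S) : S := exist _ (f (bss_val x)) (asboolT (fZ _ (ZGval x)).1).
exists v; do 2!split=> //; last by move=> x; exact: (fZ _ (ZGval x)).2.
by move=> a x y; apply: bss_val_inj; rewrite bss_valP; exact: flin.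
Qed.

Lemma subseq_contraction (n : nat -> nat) : {homo n : i j / (i < j)%N} ->
  exists v : S -> S, bss_contraction v /\
    forall x, bss_val (v x) = bss_val x \o n.
Proof.
move=> n_homo.
apply: (bss_contraction_exists (f := fun x => x \o n)) => // x Zx.
exact: seqs_subseq.
Qed.

Lemma spread_contraction (n : nat -> nat) : {homo n : i j / (i < j)%N} ->
  exists v : S -> S, bss_contraction v /\
    forall x, is_spread n (bss_val x) (bss_val (v x)).
Proof.
move=> n_homo; have n_inj : injective n.
  by move=> i j ij; case: (ltngtP i j) => // /n_homo; rewrite ij ltnn.
(* A partial inverse of [n], chosen independently of the sequence, makes spreading a linear map. *)
have inv_n j : exists o : option nat,
    if o is Some i then n i = j else ~ range n j.
  have [[i _ ij]|] := pselect (range n j); first by exists (Some i).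
  by exists None.
have [o oP] := choice inv_n.
pose f (x : nat -> G) j := if o j is Some i then x i else 0.
have f_spread x : is_spread n x (f x).
  split=> [i|j nj]; rewrite /f.
    by have := oP (n i); case: (o _) => [k /n_inj ->//|[]]; exists i.
  by have := oP j; case: (o _) => // i ij; case: nj; exists i.
have [||v [vc vE]] := @bss_contraction_exists f.
- move=> a x y; apply/funext => j; rewrite /f /=.
  rewrite -[RHS]/(a *: f x j + f y j) /f.
  by case: (o j) => //; rewrite scaler0 addr0.
- by move=> x Zx; exact: seqs_spread (f_spread x) Zx.
by exists v; split=> // x; rewrite vE.
Qed.

End SequenceSpaceOperators.

Lemma bss_contraction_bounded (K : numFieldType) (S : banachSequenceSpace K)
    (v : S -> S) : bss_contraction v -> bounded_linear v.
Proof. by move=> [vlin v1]; split=> //; exists 1 => x; rewrite mul1r. Qed.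

Lemma qspace_valZ (K : numFieldType) (T : Type) (F : lmodType K)
    (W : quasiNormedSubspace (T -> F)) (a : K) (f : qspace W) (x : T) :
  qspace_val (a *: f) x = a *: qspace_val f x.
Proof. by []. Qed.

(** The ideal inequality with the identity on the right suffices, both operator norms being at most
    1. *)
Lemma ideal_postcomp (R : realType) (s : scalarKind)
    (S : banachSequenceSpace (scalars R s))
    (E : completeNormedModType (scalars R s)) (I : quasiBanachIdeal R s)
    (v : S -> S) : bss_contraction v ->
  exists L : {linear qspace (I E S) -> qspace (I E S)},
    (forall T, qspace_norm (L T) <= qspace_norm T) /\
    forall T, qspace_val (L T) = v \o qspace_val T.
Proof.
move=> vc; have [vlin v1] := vc; have vb := bss_contraction_bounded vc.
have v0 : v 0 = 0.
  by have := vlin (-1) 0 0; rewrite scaler0 addr0 scaleN1r addNr.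
have idb : @bounded_linear (scalars R s) E E id.
  by split=> [a x y //|]; exists 1 => x; rewrite mul1r.
have comp (T : qspace (I E S)) := ideal_comp idb (qspaceP T) vb.
pose f (T : qspace (I E S)) : qspace (I E S) :=
  exist _ (v \o qspace_val T) (asboolT (comp T).1).
have flin : linear f.
  move=> a T U; apply/val_inj/funext => x.
  exact: (vlin a (qspace_val T x) (qspace_val U x)).
pose fL := GRing.isLinear.Build _ _ _ _ f flin.
pose L : {linear qspace (I E S) -> qspace (I E S)} := HB.pack f fL.
exists L; split=> // T; apply: (le_trans (comp T).2).
have /andP[ov0 ov1] := opnorm_contraction v0 v1.
have /andP[oi0 oi1] : 0 <= opnorm (@id E) <= 1 by exact: opnorm_contraction.
have T0 := qspace_ge0 T.
apply: (@le_trans _ _ (qspace_norm T * opnorm (@id E))).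
  by rewrite ler_wpM2r// ler_piMl.
by rewrite ler_piMr.
Qed.

(** * Stability properties of summing operators *)

Section Summing.
Context {K : numFieldType} (X Y : standardSequenceClass K).
Context (E F : completeNormedModType K).

Lemma summing_lincomb (a : K) (f g h : E -> F) : bounded_linear h ->
  h = (fun x => a *: f x + g x) ->
  summing X Y E F f -> summing X Y E F g -> summing X Y E F h.
Proof.
move=> hb hE [_ fs] [_ gs]; split=> // x Xx.
by rewrite hE; exact: qcarrierP (fs x Xx) (gs x Xx).
Qed.

Lemma summing_zero (h : E -> F) : bounded_linear h -> (forall x, h x = 0) ->
  summing X Y E F h.
Proof.
move=> hb h0; split=> // x _.
have -> : h \o x = (fun=> 0) by apply/funext => n; exact: h0.
exact: (qcarrier0 (Y F)).
Qed.

Lemma summing_scale (a : K) (f h : E -> F) : bounded_linear h ->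
  (forall x, h x = a *: f x) -> summing X Y E F f -> summing X Y E F h.
Proof.
move=> hb hE [_ fs]; split=> // x /fs Yfx.
have -> : h \o x = a *: (f \o x) + 0.
  by rewrite addr0; apply/funext => n; exact: hE.
exact/qcarrierP/(qcarrier0 (Y F)).
Qed.

Lemma summing_postcomp (v : F -> F) (f h : E -> F) : linearly_stable Y ->
  bounded_linear v -> bounded_linear h -> h = v \o f ->
  summing X Y E F f -> summing X Y E F h.
Proof.
move=> Yst /Yst[_ vs] hb hE [_ fs]; split=> // x; rewrite hE => /fs; exact: vs.
Qed.

End Summing.

Theorem theorem4p4 (R : realType) (s : scalarKind)
    (S : banachSequenceSpace (scalars R s))
    (X Y : standardSequenceClass (scalars R s))
    (Y_stable : linearly_stable Y)
    (E : completeNormedModType (scalars R s))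
    (I : quasiBanachIdeal R s) :
  let A : set (qspace (I E S)) :=
    [set T : qspace (I E S) | ~ summing X Y E S (qspace_val T)] in
  A = set0 \/ pointwise_continuum_spaceable R A.
Proof.
(* Spaceability is vacuous for an empty set, so the second alternative can be proved in all
   cases. *)
move=> A; right => T AT.
pose summ (U : qspace (I E S)) := summing X Y E S (qspace_val U).
have bnd (U : qspace (I E S)) : bounded_linear (qspace_val U).
  by apply: ideal_bounded; exact: qspaceP.
have [P0 P0P] := choice (fun bk : bool * nat =>
  subseq_contraction S (@block_homo bk.1 bk.2)).
have [S0 S0P] := choice (fun bk : bool * nat =>
  spread_contraction S (@block_homo bk.1 bk.2)).
have [P PP] := choice (fun bk => ideal_postcomp E I (P0P bk).1).
have [Q QP] := choice (fun bk => ideal_postcomp E I (S0P bk).1).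
have summ_post v (vc : bss_contraction v) U U' : summ U ->
    qspace_val U' = v \o qspace_val U -> summ U'.
  move=> sU UU'; apply: (summing_postcomp Y_stable _ (bnd U') UU' sU).
  exact: bss_contraction_bounded.
(* If both parity restrictions were summing, spreading them back and adding would make [T]
   summing. *)
have [b bT] : exists b, ~ summ (P (b, 0%N) T).
  apply: contrapT => h; apply: AT.
  have sPT b : summ (P (b, 0%N) T).
    by apply: contrapT => sb; apply: h; exists b.
  have sQPT b : summ (Q (b, 0%N) (P (b, 0%N) T)).
    exact: summ_post _ (S0P _).1 _ _ (sPT b) ((QP _).2 _).
  apply: (summing_lincomb (a := 1) (bnd T) _ (sQPT true) (sQPT false)).
  apply/funext => x; apply: bss_val_inj; rewrite bss_valP scale1r.
  rewrite !(QP _).2 !(PP _).2; apply/funext => m.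
  set z := qspace_val T x.
  have half c : bss_val (S0 (c, 0%N) (P0 (c, 0%N) z)) m =
      if odd m == c then bss_val z m else 0.
    have [S0n S0N] := (S0P (c, 0%N)).2 (P0 (c, 0%N) z).
    case: eqP => [mc|mc]; last first.
      apply: S0N => -[i _ im]; apply: mc; rewrite -im /= oddD odd_double addbF.
      by case: (c).
    have mE : m = block c 0 m./2 by rewrite /= -mc odd_double_half.
    by rewrite [in LHS]mE S0n (P0P _).2 [in RHS]mE.
  rewrite -[RHS]/(bss_val (S0 (true, 0%N) (P0 (true, 0%N) z)) m +
    bss_val (S0 (false, 0%N) (P0 (false, 0%N) z)) m) !half.
  by case: (odd m); rewrite (addr0, add0r).
pose p k := P (b, k).
pose u := p 0%N T.
(* Restriction preserves summing by linear stability, so a summing [x] would make [u] summing after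
   division by [a]. *)
have u_summ a k (x : qspace (I E S)) : a <> 0 -> p k x = a *: u -> ~ summ x.
  move=> a0 xu sx; apply: bT.
  have spx : summ (p k x) by exact: summ_post _ (P0P _).1 _ _ sx ((PP _).2 _).
  apply: (summing_scale (a := a^-1) (bnd _) _ spx) => y.
  by rewrite xu qspace_valZ scalerA mulVf ?scale1r//; exact/eqP.
have u0 : u <> 0.
  by move=> u0; apply: bT; rewrite -/(u) u0; exact: summing_zero.
have p_sep (x : qspace (I E S)) : (forall k, p k x = 0) -> x = 0.
  move=> px; apply/val_inj/funext => y; apply/bss_val_inj/funext => m.
  have [k [i <-]] := block_surj b m.
  have := congr1 (fun U : qspace (I E S) => bss_val (qspace_val U y) i) (px k).
  by rewrite (PP _).2 /= (P0P _).2.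
(* Restricting to block [j] undoes spreading along the same block, and sees only zeros after
   spreading along a disjoint one. *)
have pQ j k (U : qspace (I E S)) : p j (Q (b, k) U) = (j == k)%:R *: U.
  apply/val_inj/funext => y; apply/bss_val_inj/funext => i.
  rewrite -[LHS]/(bss_val (qspace_val (p j (Q (b, k) U)) y) i).
  rewrite (PP _).2 (QP _).2 /= (P0P _).2 /=.
  have [S0n S0N] := (S0P (b, k)).2 (qspace_val U y).
  have [->|jk] := eqVneq j k; first by rewrite S0n scale1r.
  rewrite S0N ?scale0r// => -[i' _ /block_inj[/= kj _]].
  by rewrite kj eqxx in jk.
have p_contr k x : qspace_norm (p k x) <= qspace_norm x by exact: (PP _).1.
(* The shift leaves block 0 empty, so these operators fit the case [c = 0]. *)
pose e k := Q (b, k.+1) u.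
have p0e k : p 0%N (e k) = 0 by rewrite pQ scale0r.
have pSe j k : p j.+1 (e k) = (j == k)%:R *: u by rewrite pQ eqSS.
have e_le k : qspace_norm (e k) <= qspace_norm u by exact: (QP _).1.
exists (blockwise_multiples p T u); split.
- exact: blockwise_multiples_subspace.
- exact: blockwise_multiples_closed.
- exact: (blockwise_multiples_dim T p_contr p_sep u0 p0e pSe e_le).
- exact: blockwise_multiples_gen.
- move=> x Mx; have [->|x0] := eqVneq x 0; first by right.
  left; have [|k [a [a0 xu]]] := blockwise_multiples_neq0 p_sep Mx.
    exact/eqP.
  exact: u_summ a0 xu.
Qed.
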